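(* Let $(X,d)$ be a compact metric space, let $\phi_m:X\to X$, $m=1,2,\ldots$, be a sequence of homeomorphisms, and let $n\ge 1$ be an integer. The non-autonomous system $(X,\phi_{1,\infty})$ is $n$-expansive (in the two-sided sense for sequences of homeomorphisms) if and only if there is a finite open cover $\mathcal{B}$ of $X$ such that for every bisequence $\{B_m\}_{m=-\infty}^{\infty}$ of members of $\mathcal{B}$, the set $\bigcap_{m=-\infty}^{\infty}(\phi_1^m)^{-1}(\overline{B_m})$ has at most $n$ elements.
   Context: For a sequence of homeomorphisms $\phi_{1,\infty}=\{\phi_m\}_{m=1}^\infty$ of $X$, write $\phi_1^m=\phi_m\circ\phi_{m-1}\circ\cdots\circ\phi_1$ for $m\ge 1$, $\phi_1^0=\mathrm{id}_X$, and $\phi_1^{-m}=(\phi_1^m)^{-1}$ for $m\ge 1$. A sequence of homeomorphisms $\phi_{1,\infty}$ of $(X,d)$ is $n$-expansive if there is a constant $c>0$ such that for every $x\in X$ the set $\{y\in X: d(\phi_1^i(x),\phi_1^i(y))\le c \text{ for all } i\in\mathbb{Z}\}$ has at most $n$ elements. $\overline{B}$ denotes the closure of $B$; the sets $(\phi_1^m)^{-1}(\overline{B_m})$ are preimages under $\phi_1^m$. *)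

(* Defs.v *)
From HB Require Import structures.
From mathcomp Require Import all_boot all_order all_algebra.
From mathcomp Require Import all_classical all_reals all_analysis.

Set Implicit Arguments.
Unset Strict Implicit.
Unset Printing Implicit Defensive.

Import Order.TTheory GRing.Theory Num.Theory.

Local Open Scope classical_set_scope.
Local Open Scope card_scope.
Local Open Scope ring_scope.

(* {splitbij _ >-> _} bundles f with its (unique) two-sided inverse f^-1. *)
Definition homeomorphism (X : topologicalType)
    (f : {splitbij [set: X] >-> [set: X]}) : Prop :=
  continuous f /\ continuous f^-1%FUN.

Section nonautonomous.
Variable X : topologicalType.

(* Sequences are indexed from 0: phi m stands for the map with index m + 1,   *)
(* so that forward phi m is the composite of the first m maps.                *)
Implicit Type phi : nat -> {splitbij [set: X] >-> [set: X]}.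

Fixpoint forward phi (m : nat) : {splitbij [set: X] >-> [set: X]} :=
  if m is k.+1 then [splitbij of phi k \o forward phi k]
  else [splitbij of @idfun X].

(* Negz k is the integer - (k + 1). *)
Definition evolution phi (i : int) : X -> X :=
  match i with
  | Posz m => forward phi m
  | Negz k => (forward phi k.+1)^-1%FUN
  end.

End nonautonomous.

Definition n_expansive (R : realType) (X : metricType R) (n : nat)
    (phi : nat -> {splitbij [set: X] >-> [set: X]}) : Prop :=
  exists2 c : R, 0 < c &
    forall x : X,
      [set y : X | forall i : int,
         mdist (evolution phi i x) (evolution phi i y) <= c] #<= `I_n.

Definition finite_open_cover (X : topologicalType) (B : set (set X)) : Prop :=
  [/\ finite_set B, forall U, B U -> open U & cover B id = [set: X]].

(* Main.v *)
(** Given an expansivity constant c, a finite cover by balls so small that their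
    closures have diameter below c puts each intersection inside the set of
    points whose orbits stay c-close to that of any one of its elements.
    Conversely, half of a Lebesgue number e of the cover is an expansivity
    constant: around each point of the orbit of x, the ball of radius e lies in
    a single member of the cover. *)

Require Import Defs.
From HB Require Import structures.
From mathcomp Require Import all_boot all_order all_algebra.
From mathcomp Require Import all_classical all_reals all_analysis.

Set Implicit Arguments.
Unset Strict Implicit.
Unset Printing Implicit Defensive.

Import Order.TTheory GRing.Theory Num.Theory.

Local Open Scope classical_set_scope.
Local Open Scope card_scope.
Local Open Scope ring_scope.

(* [compact_cover] would require X to be pointed, hence the near-covering
   characterization of compactness, along the filter of large finite sets. *)
Lemma compact_finite_ball_cover (R : realType) (X : pseudoMetricType R)
    (e : R) : compact [set: X] -> 0 < e ->
  exists2 S : set X, finite_set S &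
    cover S (fun x => (ball x e)^°) = [set: X].
Proof.
move=> cptX e0.
pose F : set_system (set X) := filter_from finite_set
  (fun A => [set S | finite_set S /\ A `<=` S]).
have FF : Filter F.
  apply: filter_from_filter; first by exists set0; exact: finite_set0.
  move=> A A' finA finA'; exists (A `|` A'); first by rewrite finite_setU.
  by move=> S [finS]; rewrite subUset => -[AS A'S].
have := cptX; rewrite compact_near_coveringP.
move=> /(_ _ F (fun S x => exists2 y, S y & (ball y e)^° x) FF).
case=> [x _|A finA Acov].
  (* Points near [x] are covered by the ball about [x] itself once [S] contains [x]. *)
  exists ((ball x e)^°, [set S | finite_set S /\ [set x] `<=` S]).
    split; first exact/nbhs_interior/nbhsx_ballx.
    by exists [set x]; first exact: finite_set1.
  by move=> [x' S] /= [xx' [_ xS]]; exists x => //; exact: xS.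
exists A => //; apply/seteqP; split=> // x _.
have [//|y Ay yx] := Acov A (conj finA (@subset_refl _ A)) x.
by exists y.
Qed.

(** If [ball x r] lies in [U], so does every ball of radius below [r / 2] about a point within
    [r / 2] of [x]; near-covering along [0^'+] makes this local bound uniform. *)
Lemma lebesgue_number (R : realType) (X : pseudoMetricType R)
    (B : set (set X)) :
  compact [set: X] -> (forall U, B U -> open U) -> cover B id = [set: X] ->
  exists2 e : R, 0 < e & forall x, exists2 U, B U & ball x e `<=` U.
Proof.
move=> cptX Bopen Bcov.
have := cptX; rewrite compact_near_coveringP.
move=> /(_ _ (0 : R)^'+ (fun e x => exists2 U, B U & ball x e `<=` U)).
case=> [x _|].
  have [U BU Ux] : cover B id x by rewrite Bcov.
  have /nbhs_ballP[r /= r0 rU] := open_nbhs_nbhs (conj (Bopen U BU) Ux).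
  exists (ball x (r / 2), [set e : R | e < r / 2]).
    split; first by apply: nbhsx_ballx; rewrite divr_gt0.
    by apply: nbhs_right_lt; rewrite divr_gt0.
  move=> [y e] /= [xy er]; exists U => // z yz; apply: rU.
  rewrite (splitr r); apply: ball_triangle xy _.
  exact: le_ball (ltW er) _ yz.
move=> r /= r0 Hr; exists (r / 2); first by rewrite divr_gt0.
move=> x; apply: Hr => //=; last by rewrite divr_gt0.
by rewrite sub0r normrN gtr0_norm ?divr_gt0// ltr_pdivrMr// ltr_pMr// ltr1n.
Qed.

Theorem theorem3p1 (R : realType) (X : metricType R)
    (cptX : compact [set: X])
    (phi : nat -> {splitbij [set: X] >-> [set: X]})
    (homeo_phi : forall m, homeomorphism (phi m))
    (n : nat) (n_ge1 : (1 <= n)%N) :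
  n_expansive n phi <->
  exists2 B : set (set X), finite_open_cover B &
    forall b : int -> set X, (forall m, B (b m)) ->
      \bigcap_(m in [set: int]) (evolution phi m @^-1` closure (b m)) #<= `I_n.
Proof.
split=> [[c c0 exp]|[B [_ Bopen Bcov] Bcard]].
  (* The closure of a ball of radius [c / 2 / 2] lies in the ball of radius [c / 2], whose points
     are less than [c] apart. *)
  have [|S finS Scov] := @compact_finite_ball_cover R X (c / 2 / 2) cptX.
    by rewrite !divr_gt0.
  exists [set (ball x (c / 2 / 2))^° | x in S].
    split; first exact: finite_image.
      by move=> _ [x _ <-]; exact: open_interior.
    by rewrite /cover bigcup_image.
  move=> b Bb; set I := \bigcap_(m in _) _.
  (* Expansivity needs a centre, taken in the intersection itself. *)
  have [->|/set0P[x Ix]] := eqVneq I set0; first exact: card_ge0.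
  apply: card_le_trans (exp x); apply: subset_card_le => y Iy m /=.
  have [z _ bz] := Bb m.
  have zb : closure (b m) `<=` ball z (c / 2).
    have c20 : 0 < c / 2 by rewrite divr_gt0.
    apply: subset_trans (subset_closure_half (x := z) c20).
    by rewrite -bz -closure_ballE; apply: closureS; exact: interior_subset.
  have : ball (evolution phi m x) c (evolution phi m y).
    rewrite (splitr c); apply: (@ball_triangle _ _ z).
      by apply: ball_sym; exact/zb/Ix.
    exact/zb/Iy.
  by rewrite ballEmdist => /ltW.
have [e e0 eB] := lebesgue_number cptX Bopen Bcov.
(* Halving turns the non-strict bound of [n_expansive] into the strict one of [ball]. *)
exists (e / 2); first by rewrite divr_gt0.
move=> x; pose b m := projT1 (cid2 (eB (evolution phi m x))).
have bB m : B (b m) by rewrite /b; case: cid2.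
have xb m : ball (evolution phi m x) e `<=` b m by rewrite /b; case: cid2.
apply: card_le_trans (Bcard b bB); apply: subset_card_le => y xy m _.
apply/subset_closure/xb; rewrite ballEmdist /=.
by rewrite (le_lt_trans (xy m))// ltr_pdivrMr// ltr_pMr// ltr1n.
Qed.
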